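(* For $n\ge 5$, $$J_{n,5}(t)=t^5-\frac{10p_2}{n(n-1)}t^3-\frac{20p_3}{n(n-1)(n-2)}t^2+\frac{15p_2^2-30p_4}{n(n-1)(n-2)(n-3)}t+\frac{20p_2p_3-24p_5}{n(n-1)(n-2)(n-3)(n-4)}.$$ Thus the discriminant of this quintic is a universal polynomial in $p_2,p_3,p_4,p_5$ (with coefficients depending only on $n$), and it is nonnegative whenever the roots $x_1,\dots,x_n$ are real.
   Context: Let $P(t)=\prod_{i=1}^n(t-x_i)$ with the roots translated so that $\sum_i x_i=0$. Put $J_{n,5}(t)=\frac{5!}{n!}P^{(n-5)}(t)$ and $p_r=\sum_{i=1}^n x_i^r$. *)

(* Defs.v *)
From mathcomp Require Export all_boot all_order all_algebra.
From mathcomp Require Export mpoly.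

Set Implicit Arguments.
Unset Strict Implicit.
Unset Printing Implicit Defensive.

Import GRing.Theory Num.Theory.
Local Open Scope ring_scope.

Definition root_poly (F : fieldType) (n : nat) (x : 'I_n -> F) : {poly F} :=
  \prod_(i < n) ('X - (x i)%:P).

Definition jpoly (F : fieldType) (n k : nat) (x : 'I_n -> F) : {poly F} :=
  (k`!%:R / n`!%:R) *: (root_poly x)^`(n - k).

Definition psum (F : fieldType) (n : nat) (x : 'I_n -> F) (r : nat) : F :=
  \sum_(i < n) x i ^+ r.

(* disc p = (-1)^(d(d-1)/2) Res(p, p') / lc(p), with d = deg p > 0.
   The Sylvester matrix behind [resultant] lists coefficients by increasing
   degree, which changes the classical Res(p, q) by (-1)^(deg p * deg q); for
   q = p' over a field of characteristic 0 this is (-1)^(d(d-1)) = 1, so the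
   normalization is the usual one: lc(p)^(2d-2) \prod_(i<j) (r_i - r_j)^2. *)
Definition discriminant (F : fieldType) (p : {poly F}) : F :=
  (-1) ^+ 'C((size p).-1, 2) * resultant p p^`() / lead_coef p.

(* Main.v *)
(** Newton's identities for the coefficients of [\prod (1 - x_i X)] express the
    coefficients of the root polynomial through power sums; with vanishing first
    power sum this gives the quintic.  Its discriminant is the image of the
    resultant of a generic quintic over [{mpoly rat[4]}].  When the roots are
    real, so are the critical points (Gauss-Lucas), hence the quintic is
    real-rooted and its discriminant [\prod_(i < j) (r_i - r_j)^2] is a product
    of squares of real numbers. *)

Require Import Defs.
From mathcomp Require Import all_boot all_order all_fingroup all_algebra.
From mathcomp Require Import mpoly ring zify.
Set Implicit Arguments.
Unset Strict Implicit.
Unset Printing Implicit Defensive.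
Import GRing.Theory Num.Theory.
Local Open Scope ring_scope.

(** * Newton's identities for the reversed root polynomial *)

(** The coefficient of degree k is the signed elementary symmetric function (-1)^k e_k of [s].
    Indexing by a list lets inductions add one root at a time. *)
Definition rev_root_poly (R : comNzRingType) (s : seq R) : {poly R} :=
  \prod_(y <- s) (1 - y *: 'X).

Lemma coef_rev_root_poly_cons (R : comNzRingType) (y : R) (s : seq R) k :
  (rev_root_poly (y :: s))`_k.+1 =
  (rev_root_poly s)`_k.+1 - y * (rev_root_poly s)`_k.
Proof.
by rewrite /rev_root_poly big_cons mulrBl mul1r coefB -scalerAl coefZ coefXM.
Qed.

Lemma coef0_rev_root_poly (R : comNzRingType) (s : seq R) :
  (rev_root_poly s)`_0 = 1.
Proof.
elim: s => [|y s IHs]; first by rewrite /rev_root_poly big_nil coefC.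
rewrite /rev_root_poly big_cons mulrBl mul1r coefB -scalerAl coefZ coefXM /=.
by rewrite mulr0 subr0.
Qed.

Lemma size_rev_root_poly (R : comNzRingType) (s : seq R) :
  (size (rev_root_poly s) <= (size s).+1)%N.
Proof.
elim: s => [|y s IHs]; first by rewrite /rev_root_poly big_nil size_poly1.
apply/leq_sizeP => -[|k] // lt_sk; rewrite coef_rev_root_poly_cons.
by rewrite !(leq_sizeP _ _ IHs) ?mulr0 ?subr0 //; apply: ltnW.
Qed.

Lemma rev_root_polyE (R : comNzRingType) (s : seq R) k : (k <= size s)%N ->
  (\prod_(y <- s) ('X - y%:P))`_(size s - k) = (rev_root_poly s)`_k.
Proof.
elim: s k => [|y s IHs] [|k] //.
- by rewrite /rev_root_poly !big_nil.
- move=> _; rewrite subn0 coef0_rev_root_poly -[X in _`_X]succnK.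
  by rewrite -(size_prod_XsubC _ id); apply/monicP/monic_prod_XsubC.
rewrite ltnS => le_ks /=; rewrite subSS coef_rev_root_poly_cons big_cons.
rewrite mulrBl coefB coefXM coefCM IHs //; congr (_ - _).
(* At the boundary both sides are 0: the left one is the constant term of a multiple of ['X], the
   right one lies beyond the degree of [rev_root_poly s]. *)
have [->|ne_ks] := eqVneq k (size s).
  by rewrite subnn [RHS]nth_default ?size_rev_root_poly.
have lt_ks : (k < size s)%N by rewrite ltn_neqAle ne_ks.
by rewrite subn_eq0 leqNgt lt_ks /= -subnS IHs.
Qed.

(** The sum is a coefficient of the geometric series y/(1 - yX) times [rev_root_poly (y :: s)], in
    which the factor 1 - yX cancels. *)
Lemma sum_expr_rev_root_poly (R : comNzRingType) (y : R) (s : seq R) k :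
  \sum_(i < k.+1) y ^+ i.+1 * (rev_root_poly (y :: s))`_(k - i) =
  y * (rev_root_poly s)`_k.
Proof.
elim: k => [|k IHk].
  by rewrite big_ord1 /= !coef0_rev_root_poly expr1.
rewrite big_ord_recl /= subn0 expr1 coef_rev_root_poly_cons.
under eq_bigr => i _ do rewrite /= /bump /= add1n subSS exprS -mulrA.
by rewrite -big_distrr /= IHk mulrBr subrK.
Qed.

Lemma newton_rev_root_poly (R : comNzRingType) (s : seq R) k :
  k%:R * (rev_root_poly s)`_k +
  \sum_(i < k) (\sum_(y <- s) y ^+ i.+1) * (rev_root_poly s)`_(k.-1 - i) = 0.
Proof.
elim: s k => [|y s IHs] [|k]; rewrite ?big_ord0 ?mul0r ?addr0 //.
  rewrite /rev_root_poly big_nil coef1 mulr0 big1 ?addr0 // => i _.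
  by rewrite big_nil mul0r.
under eq_bigr => i _ do rewrite big_cons mulrDl.
rewrite big_split /= sum_expr_rev_root_poly coef_rev_root_poly_cons.
(* Pairing the old power sums with the new polynomial combines the identities for [s] in degree
   [k.+1] and, scaled by -y, in degree [k]. *)
suff -> : \sum_(i < k.+1) (\sum_(z <- s) z ^+ i.+1) *
             (rev_root_poly (y :: s))`_(k - i) =
          - (k.+1%:R * (rev_root_poly s)`_k.+1) + y * (k%:R * (rev_root_poly s)`_k).
  rewrite -natr1; ring.
rewrite (_ : - _ = \sum_(i < k.+1) (\sum_(z <- s) z ^+ i.+1) *
  (rev_root_poly s)`_(k - i));
  last by apply/esym/eqP; rewrite -addr_eq0 addrC (IHs k.+1).
rewrite (_ : k%:R * _ = - \sum_(i < k) (\sum_(z <- s) z ^+ i.+1) *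
  (rev_root_poly s)`_(k.-1 - i)); last by apply/eqP; rewrite -addr_eq0 IHs.
rewrite !big_ord_recr /= !subnn !coef0_rev_root_poly mulrN addrAC; congr (_ + _).
rewrite big_distrr -sumrB; apply: eq_bigr => i _.
have -> : (k - i = (k.-1 - i).+1)%N by case: k i => [[]|k [i /=]] // lt_ik; lia.
rewrite coef_rev_root_poly_cons /=; ring.
Qed.

(** * Exchanging the arguments of a resultant *)

Lemma odd_perm_addr k (a : 'I_k.+1) : odd k.+1 -> perm (addIr a) = false :> bool.
Proof.
move=> odd_k; have: (perm (addIr a) ^+ k.+1 = 1)%g.
  apply/permP=> i; rewrite permX perm1.
  have iterE m : iter m (perm (addIr a)) i = i + a *+ m.
    by elim: m => [|m IHm]; rewrite ?addr0 // iterS IHm permE mulrSr addrA.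
  rewrite iterE Zp_mulrn /= -[RHS]addr0; congr (_ + _).
  by apply/val_inj; rewrite /= modnMl.
have odd_permX m (s : 'S_k.+1) : odd_perm (s ^+ m) = odd m && s.
  elim: m => [|m IHm]; first by rewrite expg0 odd_perm1.
  by rewrite expgS odd_permM IHm /=; case: (odd m); case: (s : bool).
by move/(congr1 (@odd_perm _)); rewrite odd_perm1 odd_permX odd_k.
Qed.

(* A rotation of an odd number of rows has odd order, hence is even. *)
Lemma det_rotate_rows (R : comNzRingType) k a (F : nat -> nat -> R) : odd k ->
  \det (\matrix_(i < k, j < k) F ((i + a) %% k)%N j) =
  \det (\matrix_(i < k, j < k) F i j).
Proof.
case: k => // k odd_k; pose s : 'S_k.+1 := perm (addIr (inZp a)).
(* The factor 1 is rewritten as the sign of [s], then as the determinant of its permutation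
   matrix. *)
rewrite -[RHS]mul1r -(expr0 (-1)) -[0%N]/(nat_of_bool false).
rewrite -(odd_perm_addr (inZp a) odd_k) -det_perm -det_mulmx -row_permE.
by congr (\det _); apply/matrixP=> i j; rewrite !mxE permE /= modnDmr.
Qed.

(** Entries depend on natural number indices and the dimensions are variables, so rows can be
    rotated and dimensions rewritten without casts. *)
Lemma resultantE (R : nzRingType) (p q : {poly R}) m n :
  (size p).-1 = m -> (size q).-1 = n ->
  resultant p q = \det (\matrix_(i < n + m, j < n + m)
    (if (i < n)%N then p`_(j - i) *+ (i <= j)
     else q`_(j - (i - n)) *+ (i - n <= j))).
Proof.
move=> <- <-; congr (\det _); apply/matrixP=> i j.
rewrite Sylvester_mxE mxE; by case: splitP => i' -> //; rewrite addKn.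
Qed.

(** Swapping the two row blocks of the Sylvester matrix is a rotation of its rows, whose number is
    odd here. *)
Lemma resultantC_odd (R : comNzRingType) (p q : {poly R}) :
  odd ((size p).-1 + (size q).-1) -> resultant p q = resultant q p.
Proof.
set m := (size p).-1; set n := (size q).-1 => odd_mn.
rewrite (@resultantE _ p q m n) // (@resultantE _ q p n m) // [(n + m)%N]addnC.
pose S i j := if (i < n)%N then p`_(j - i) *+ (i <= j)%N
              else q`_(j - (i - n)) *+ (i - n <= j)%N.
rewrite -(det_rotate_rows n S odd_mn) /S.
congr (\det _); apply/matrixP=> i j; rewrite !mxE.
have [lt_im|le_mi] := ltnP i m.
  rewrite modn_small; last by rewrite ltn_add2r.
  by rewrite ltnNge leq_addl /= addnK.
have -> : ((i + n) %% (m + n) = i - m)%N.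
  have -> : (i + n = i - m + (m + n))%N by lia.
  by rewrite modnDr modn_small //; have := ltn_ord i; lia.
by rewrite ifT //; have := ltn_ord i; lia.
Qed.

(** * Resultant with a split polynomial *)

Lemma det_Vandermonde_neq0 (F : fieldType) d (r : 'I_d -> F) :
  injective r -> \det (Vandermonde d (\row_i r i)) != 0.
Proof.
move=> r_inj; rewrite det_Vandermonde; apply/prodf_neq0 => i _.
apply/prodf_neq0 => j lt_ij; rewrite !mxE subr_eq0 (inj_eq r_inj).
by rewrite eq_sym -val_eqE neq_ltn lt_ij.
Qed.

Lemma size_root_poly (F : fieldType) d (r : 'I_d -> F) :
  size (root_poly r) = d.+1.
Proof. by rewrite size_prod_XsubC /index_enum -enumT size_enum_ord. Qed.

(** Row i of the band lists the coefficients of X^i p, so multiplying it by the powers of a_j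
    evaluates X^i p at a_j. The size bound makes these coefficients fit in [N] columns. *)
Lemma mul_band_Vandermonde (R : comNzRingType) m N k (p : {poly R})
    (a : 'rV[R]_k) : (m + size p <= N.+1)%N ->
  (\matrix_(i < m, j < N) (p`_(j - i) *+ (i <= j))) *m Vandermonde N a =
  Vandermonde m a *m diag_mx (\row_j p.[a 0 j]).
Proof.
move=> le_N; apply/matrixP=> i j.
rewrite mul_mx_diag !mxE -[_ ^+ i]hornerXn -hornerM.
rewrite (@horner_coef_wide _ N) ?size_polyMXn.
  by apply: eq_bigr => l _; rewrite !mxE coefXnM ltnNge if_neg -mulrb.
apply: leq_trans (size_polyMleq _ _) _; rewrite size_polyXn addSn -ltnS.
by apply: leq_trans le_N; rewrite -addSn leq_add2r.
Qed.

(* Multiplying the Sylvester matrix by the columns of powers of the roots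
   annihilates the rows of [root_poly r]; completing these columns with the
   unit vectors of the high degrees makes everything block triangular. *)
Lemma resultant_root_poly (F : fieldType) d (r : 'I_d -> F) (q : {poly F}) :
  injective r -> q != 0 ->
  resultant q (root_poly r) = \prod_i q.[r i].
Proof.
move=> r_inj q_neq0; set p := root_poly r; set n := (size q).-1.
have szq : size q = n.+1 by rewrite /n prednK // size_poly_gt0.
have szp : (size p).-1 = d by rewrite size_root_poly.
rewrite (@resultantE _ q p n d) //.
pose B m (s : {poly F}) : 'M[F]_(m, d + n) :=
  \matrix_(i < m, j < d + n) (s`_(j - i) *+ (i <= j)).
pose a : 'rV[F]_d := \row_i r i.
set S := (X in \det X); have {S}-> : S = col_mx (B d q) (B n p).
  apply/matrixP=> i j; rewrite !mxE; case: splitP => i' ->; rewrite mxE //.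
  by rewrite addKn.
pose M := row_mx (Vandermonde (d + n) a) (col_mx 0 1%:M) : 'M[F]_(d + n).
have detM : \det M = \det (Vandermonde d a).
  have -> : M = block_mx (Vandermonde d a) 0 (dsubmx (Vandermonde (d + n) a)) 1%:M.
    rewrite /M -[X in row_mx X _]vsubmxK -block_mxEh; congr block_mx.
    by apply/matrixP=> i j; rewrite !mxE.
  by rewrite det_lblock det1 mulr1.
have := det_Vandermonde_neq0 r_inj; rewrite -/a -detM => nzM.
apply: (mulIf nzM); rewrite -det_mulmx mul_col_row.
rewrite !mul_band_Vandermonde; first last.
- by rewrite szq addnS.
- by rewrite size_root_poly addnS addnC.
rewrite [X in block_mx _ _ X _](_ : _ = 0); last first.
  apply/matrixP=> i j; rewrite mul_mx_diag !mxE.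
  by rewrite horner_prod (bigD1 j) //= hornerXsubC subrr mul0r mulr0.
rewrite det_ublock det_mulmx det_diag [X in _ * X](_ : _ = 1).
  by rewrite mulr1 mulrC detM; congr (_ * _); apply: eq_bigr => i _; rewrite !mxE.
(* The remaining block is formed by the last [n] columns of [B n p]; it is lower triangular, with
   the leading coefficient 1 of [p] on the diagonal. *)
rewrite -[B n p]hsubmxK mul_row_col mulmx0 mulmx1 add0r det_trig.
  apply: big1 => i _; rewrite !mxE /= leq_addl addnK.
  by rewrite -[d in p`_d]szp; apply/monicP/monic_prod_XsubC.
apply/is_trig_mxP=> i j lt_ij; rewrite !mxE /= nth_default ?mul0rn //.
by rewrite size_root_poly -addnBA ?(ltnW lt_ij) // -addn1 leq_add2l subn_gt0.
Qed.

(** * Discriminant of a split polynomial *)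

Lemma horner_deriv_root_poly (F : fieldType) d (r : 'I_d -> F) i :
  (root_poly r)^`().[r i] = \prod_(j | j != i) (r i - r j).
Proof.
rewrite /root_poly (bigD1 i) //= derivM derivXsubC mul1r hornerD hornerM.
rewrite !hornerE subrr mul0r addr0 horner_prod.
by apply: eq_bigr => j _; rewrite !hornerE.
Qed.

Lemma size_deriv_monic (R : nzRingType) (p : {poly R}) d :
  p \is monic -> size p = d.+1 -> d%:R != 0 :> R -> size p^`() = d.
Proof.
move=> /monicP p_mon szp nz_d; have p_neq0 : p != 0 by rewrite -size_poly_eq0 szp.
apply/eqP; rewrite eqn_leq -ltnS -szp lt_size_deriv //=.
case: d => [|d] // in szp nz_d *; rewrite ltnNge; apply: contra nz_d => le_d.
have := nth_default 0 le_d.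
have lc1 : p`_d.+1 = 1 by rewrite -p_mon lead_coefE szp.
by rewrite coef_deriv lc1 => ->.
Qed.

(** Each of the 'C(d, 2) unordered pairs occurs in both orders and contributes -(r_i - r_j)^2. *)
Lemma prod_root_differences (R : comNzRingType) d (r : 'I_d -> R) :
  \prod_i \prod_(j | j != i) (r i - r j) =
  (-1) ^+ 'C(d, 2) * \prod_(i < d) \prod_(j < d | (i < j)%N) (r i - r j) ^+ 2.
Proof.
have sgnE : \prod_(i < d) \prod_(j < d | (i < j)%N) (-1) = (-1) ^+ 'C(d, 2) :> R.
  rewrite (exchange_big_dep xpredT) //= -bin2_sum big_mkord -prodrXr.
  apply: eq_bigr => j _.
  rewrite -(big_ord_widen _ (fun=> -1 : R)) ?prodr_const ?card_ord //.
  exact: ltnW.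
rewrite -sgnE -big_split /=.
under [RHS]eq_bigr => i _ do rewrite -big_split /=.
transitivity ((\prod_(i < d) \prod_(j < d | (i < j)%N) (r i - r j)) *
              (\prod_(i < d) \prod_(j < d | (i < j)%N) (r j - r i))).
  rewrite [X in _ = _ * X](exchange_big_dep xpredT) //= -big_split /=.
  apply: eq_bigr => i _; rewrite (bigID (fun j : 'I_d => (i < j)%N)) /=.
  congr (_ * _); apply: eq_bigl => j; rewrite -val_eqE /=.
    by rewrite neq_ltn andb_orl ltnNge; lia.
  by lia.
rewrite -big_split /=; apply: eq_bigr => i _.
by rewrite -big_split /=; apply: eq_bigr => j _; ring.
Qed.

Lemma resultant_deriv_root_poly (F : numFieldType) d (r : 'I_d.+1 -> F) :
  resultant (root_poly r)^`() (root_poly r) = \prod_i (root_poly r)^`().[r i].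
Proof.
set p := root_poly r.
have szp' : size p^`() = d.+1.
  apply: size_deriv_monic (size_root_poly r) _; last by rewrite pnatr_eq0.
  exact: monic_prod_XsubC.
have p'_neq0 : p^`() != 0 by rewrite -size_poly_eq0 szp'.
have [r_inj | /injectivePn[i [j ne_ij eq_r]]] := boolP (injectiveb r).
  by rewrite resultant_root_poly //; apply/injectiveP.
(* With a repeated root both sides vanish: it is a common root of p and p', and a nonconstant gcd
   kills the resultant. *)
have p'ri0 : p^`().[r i] = 0.
  by rewrite horner_deriv_root_poly (bigD1 j) 1?eq_sym //= eq_r subrr mul0r.
rewrite (bigD1 i) //= p'ri0 mul0r; apply/eqP; rewrite resultant_eq0.
have: 'X - (r i)%:P %| gcdp p^`() p.
  rewrite dvdp_gcd !dvdp_XsubCl /root p'ri0 eqxx /= /p /root_poly horner_prod.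
  by rewrite (bigD1 i) //= hornerXsubC subrr mul0r.
by move/dvdp_leq; rewrite size_XsubC; apply; rewrite gcdp_eq0 negb_and p'_neq0.
Qed.

Lemma discriminant_root_poly (F : numFieldType) d (r : 'I_d.+1 -> F) :
  discriminant (root_poly r) =
  \prod_(i < d.+1) \prod_(j < d.+1 | (i < j)%N) (r i - r j) ^+ 2.
Proof.
have p_mon : root_poly r \is monic by rewrite monic_prod_XsubC.
have szp' : size (root_poly r)^`() = d.+1.
  by apply: size_deriv_monic p_mon (size_root_poly r) _; rewrite pnatr_eq0.
rewrite /discriminant (monicP p_mon) divr1 size_root_poly resultantC_odd.
  rewrite resultant_deriv_root_poly.
  under eq_bigr => i _ do rewrite horner_deriv_root_poly.
  by rewrite prod_root_differences mulrA -expr2 sqrr_sign mul1r.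
by rewrite size_root_poly szp' /= addnn odd_double.
Qed.

(** * Real-rootedness of derivatives and sign of the discriminant *)

Lemma horner_deriv_prod_XsubC (F : fieldType) (s : seq F) (z : F) :
  z \notin s ->
  (\prod_(y <- s) ('X - y%:P))^`().[z] =
  (\prod_(y <- s) ('X - y%:P)).[z] * \sum_(y <- s) (z - y)^-1.
Proof.
elim: s => [|y s IHs]; first by rewrite !big_nil derivC horner0 mulr0.
rewrite inE negb_or => /andP[ne_zy /IHs{}IHs]; rewrite !big_cons derivM.
rewrite derivXsubC mul1r hornerD !hornerM IHs hornerXsubC mulrDr; congr (_ + _).
  by rewrite mulrAC divff ?mul1r ?subr_eq0.
by rewrite mulrA.
Qed.

(* At a nonreal critical point z, all the terms (z - y)^-1 of the logarithmic
   derivative have an imaginary part of the same sign as that of z^*. *)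
Lemma deriv_real_rooted (C : numClosedFieldType) (p : {poly C}) :
  (forall z, root p z -> z \is Num.real) -> p^`() != 0 ->
  forall z, root p^`() z -> z \is Num.real.
Proof.
move=> p_real p'_neq0 z.
have p_neq0 : p != 0 by apply: contraNneq p'_neq0 => ->; rewrite derivC.
have [s def_p] := closed_field_poly_normal p.
have lc_neq0 : lead_coef p != 0 by rewrite lead_coef_eq0.
have s_real y : y \in s -> y \is Num.real.
  by move=> sy; apply: p_real; rewrite def_p rootZ // root_prod_XsubC.
have [/s_real // | s'z] := boolP (z \in s).
rewrite /root [in p^`()]def_p derivZ hornerZ mulf_eq0 (negPf lc_neq0) /=.
rewrite horner_deriv_prod_XsubC // mulf_eq0 => /orP[|/eqP sum0].
  by rewrite -/(root _ z) root_prod_XsubC (negPf s'z).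
(* Since 1/w = w^*/|w|^2 and each y is real, the left side is the logarithmic derivative minus its
   conjugate. *)
have: (z^* - z) * \sum_(y <- s) `|z - y| ^- 2 = 0.
  transitivity (\sum_(y <- s) (z - y)^-1 - (\sum_(y <- s) (z - y)^-1)^*); last first.
    by rewrite sum0 rmorph0 subrr.
  rewrite rmorph_sum -sumrB big_distrr /=; apply: eq_big_seq => y /s_real yR.
  rewrite (invC_norm (z - y)) rmorphM /= conjCK (conj_Creal (x := _ ^- 2)).
    by rewrite rmorphB /= (conj_Creal yR); ring.
  by rewrite rpredV rpredX ?normr_real.
move/eqP; rewrite mulf_eq0 subr_eq0 -CrealE => /orP[] //.
rewrite psumr_eq0; last by move=> y _; rewrite invr_ge0 exprn_ge0.
(* An empty [s] would make p constant; otherwise the vanishing sum of nonnegative terms forces |z -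
   y|^-2 = 0, impossible as z differs from y. *)
case: s => [|y s] in def_p s'z {s_real sum0} *.
  by case/eqP: p'_neq0; rewrite def_p big_nil derivZ derivC scaler0.
rewrite inE negb_or in s'z; case/andP: s'z => ne_zy _.
by rewrite /= invr_eq0 expf_eq0 normr_eq0 subr_eq0 (negPf ne_zy).
Qed.

Lemma derivn_real_rooted (C : numClosedFieldType) (p : {poly C}) k :
  (forall z, root p z -> z \is Num.real) -> (k < size p)%N ->
  forall z, root p^`(k) z -> z \is Num.real.
Proof.
move=> p_real; elim: k => [|k IHk] lt_kp; first by rewrite derivn0.
rewrite derivnS; apply: deriv_real_rooted; first exact/IHk/ltnW.
(* The derivative is nonzero because its top coefficient is the leading coefficient of p times a
   nonzero falling factorial. *)
rewrite -derivnS; apply/eqP=> /(congr1 (fun q : {poly C} => q`_((size p).-1 - k.+1))).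
rewrite coef_derivn subnKC ?coef0;
  last by rewrite -ltnS prednK //; apply: leq_trans lt_kp.
move/eqP; rewrite mulrn_eq0 -/(lead_coef p) lead_coef_eq0 -leqn0 leqNgt ffact_gt0.
rewrite -ltnS prednK ?lt_kp /=; last by apply: leq_trans lt_kp.
by rewrite -size_poly_eq0 -leqn0 leqNgt (leq_trans _ lt_kp).
Qed.

Lemma discriminant_real_rooted (C : numClosedFieldType) (p : {poly C}) :
  p \is monic -> (1 < size p)%N ->
  (forall z, root p z -> z \is Num.real) -> 0 <= discriminant p.
Proof.
move=> /monicP p_mon szp p_real; have [s def_p] := closed_field_poly_normal p.
rewrite p_mon scale1r in def_p; rewrite def_p in p_real szp *.
have s_real y : y \in s -> y \is Num.real by rewrite -root_prod_XsubC; apply: p_real.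
case: s => [|y s] in szp s_real {def_p p_real} *.
  by rewrite big_nil size_poly1 in szp.
rewrite (big_nth 0) big_mkord.
rewrite -[X in discriminant X]/(root_poly (fun i : 'I_(size s).+1 => (y :: s)`_i)).
rewrite discriminant_root_poly; apply: prodr_ge0 => i _; apply: prodr_ge0 => j _.
by rewrite real_exprn_even_ge0 // rpredB // s_real // mem_nth.
Qed.

(** * Newton's identities up to degree five and specialization of quintics *)

Lemma resultant_map_poly (R S : nzRingType) (f : {rmorphism R -> S}) (p q : {poly R}) :
  size (map_poly f p) = size p -> size (map_poly f q) = size q ->
  resultant (map_poly f p) (map_poly f q) = f (resultant p q).
Proof.
move=> szp szq; rewrite (resultantE (congr1 predn szp) (congr1 predn szq)).
rewrite (@resultantE _ p q _ _ erefl erefl) -det_map_mx; congr (\det _).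
by apply/matrixP=> i j; rewrite !mxE !coef_map -!rmorphMn; case: ifP.
Qed.

Lemma newton5_centered (F : numFieldType) (s : seq F) :
  let p r := \sum_(y <- s) y ^+ r in let q k := (rev_root_poly s)`_k in
  p 1%N = 0 ->
  [/\ q 1%N = 0, q 2%N = - p 2%N / 2%:R, q 3%N = - p 3%N / 3%:R,
      q 4%N = (p 2%N ^+ 2 - 2%:R * p 4%N) / 8%:R &
      q 5%N = (5%:R * p 2%N * p 3%N - 6%:R * p 5%N) / 30%:R].
Proof.
move=> p q p1; have q0 : q 0%N = 1 by apply: coef0_rev_root_poly.
(* Dividing by [k.+1] turns Newton's identity into a recursion, solved in turn up to degree 5. *)
have solve k : q k.+1 = - (\sum_(i < k.+1) p i.+1 * q (k - i)%N) / k.+1%:R.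
  have /eqP := newton_rev_root_poly s k.+1.
  by rewrite addr_eq0 => /eqP <-; rewrite mulrAC divff ?mul1r ?pnatr_eq0.
have q1 : q 1%N = 0 by rewrite solve big_ord1 p1 mul0r oppr0 mul0r.
have q2 : q 2%N = - p 2%N / 2%:R.
  by rewrite solve !big_ord_recr big_ord0 /= p1 q0; field.
have q3 : q 3%N = - p 3%N / 3%:R.
  by rewrite solve !big_ord_recr big_ord0 /= p1 q0 q1; field.
have q4 : q 4%N = (p 2%N ^+ 2 - 2%:R * p 4%N) / 8%:R.
  by rewrite solve !big_ord_recr big_ord0 /= p1 q0 q1 q2; field.
split=> //.
by rewrite solve !big_ord_recr big_ord0 /= p1 q0 q1 q2 q3; field.
Qed.

(** The base is any nonzero ring, so that the same shape serves for generic coefficients in [{mpoly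
    rat[4]}] and for their values. *)
Definition quintic (R : nzRingType) (a b c d : R) : {poly R} :=
  'X^5 - a *: 'X^3 - b *: 'X^2 + c *: 'X + d%:P.

Lemma coef_quintic (R : nzRingType) (a b c d : R) i :
  (quintic a b c d)`_i = [:: d; c; - b; - a; 0; 1]`_i.
Proof.
rewrite /quintic !(coefD, coefN, coefZ, coefXn, coefX, coefC).
case: i => [|[|[|[|[|[|i]]]]]] /=;
  by rewrite ?(mulr0, mulr1, subr0, oppr0, addr0, add0r, nth_nil).
Qed.

Lemma size_quintic (R : nzRingType) (a b c d : R) : size (quintic a b c d) = 6%N.
Proof.
apply/eqP; rewrite eqn_leq; apply/andP; split.
  by apply/leq_sizeP => i le_i; rewrite coef_quintic nth_default.
rewrite ltnNge; apply/negP=> /leq_sizeP/(_ 5 (leqnn _)).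
by rewrite coef_quintic => /eqP; rewrite oner_eq0.
Qed.

Lemma quintic_monic (R : nzRingType) (a b c d : R) : quintic a b c d \is monic.
Proof. by apply/monicP; rewrite lead_coefE size_quintic coef_quintic. Qed.

Lemma map_quintic (R S : nzRingType) (f : {rmorphism R -> S}) (a b c d : R) :
  map_poly f (quintic a b c d) = quintic (f a) (f b) (f c) (f d).
Proof.
rewrite /quintic !(rmorphD, rmorphB) /= !map_polyZ /= !map_polyXn map_polyX map_polyC.
by rewrite !raddfN /= !map_polyZ /= !map_polyXn.
Qed.

(** For a monic quintic the sign is (-1)^10 = 1 and no division remains, so the discriminant is a
    plain resultant and commutes with ring morphisms. *)
Lemma discriminant_quintic_map (R : nzRingType) (F : numFieldType)
    (f : {rmorphism R -> F}) (a b c d : R) :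
  discriminant (quintic (f a) (f b) (f c) (f d)) =
  f (resultant (quintic a b c d) (quintic a b c d)^`()).
Proof.
have nz5 : 5%:R != 0 :> F by rewrite pnatr_eq0.
rewrite /discriminant (monicP (quintic_monic _ _ _ _)) divr1 size_quintic.
rewrite (_ : 'C(5, 2) = 5 * 2)%N // exprM sqrr_sign mul1r.
rewrite -map_quintic deriv_map resultant_map_poly //.
  by rewrite map_quintic !size_quintic.
rewrite -deriv_map map_quintic.
rewrite !(size_deriv_monic (quintic_monic _ _ _ _) (size_quintic _ _ _ _)) //.
(* The derivative also has degree 4 over [R]: 5 is nonzero there because its image under [f] is. *)
by apply: contraNneq nz5 => /(congr1 f); rewrite rmorph_nat rmorph0 => ->.
Qed.

(** * Coefficients of the normalized derivative *)

Lemma factD_ffact (m j : nat) : ((m + j) ^_ m * j`! = (m + j)`!)%N.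
Proof. by have := ffact_fact (leq_addr j m); rewrite addKn. Qed.

(** Differentiating m times multiplies the coefficient of degree m + j by (m + j)!/j!, and (m + j)!
    cancels against (m + k)! = (m + k)^_(k - j) (m + j)!. Writing n = m + k avoids truncated
    subtraction. *)
Lemma coef_jpoly (F : numFieldType) (m k : nat) (x : 'I_(m + k) -> F) j :
  (j <= k)%N ->
  (jpoly k x)`_j = (k`!%:R / j`!%:R) / ((m + k) ^_ (k - j))%:R *
    (rev_root_poly [seq x i | i : 'I_(m + k)])`_(k - j).
Proof.
move=> le_jk; rewrite /jpoly addnK coefZ coef_derivn -mulr_natr.
set s := [seq x i | i : 'I_(m + k)].
have szs : size s = (m + k)%N by rewrite size_map size_enum_ord.
have -> : (root_poly x)`_(m + j) = (rev_root_poly s)`_(k - j).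
  rewrite -rev_root_polyE ?szs; last by lia.
  rewrite (_ : (m + k - (k - j) = m + j)%N); last by lia.
  by rewrite /root_poly big_image.
have E1 := factD_ffact m j.
have E2 : ((m + k) ^_ (k - j) * (m + j)`! = (m + k)`!)%N.
  by have := @ffact_fact (m + k) (k - j);
  rewrite (_ : (m + k - (k - j) = m + j)%N); [apply | ]; lia.
rewrite -E2 -E1 !natrM.
have nzf i : i`!%:R != 0 :> F by rewrite pnatr_eq0 -lt0n fact_gt0.
have nzff i l : (l <= i)%N -> (i ^_ l)%:R != 0 :> F.
  by move=> le_li; rewrite pnatr_eq0 -lt0n ffact_gt0.
field; rewrite nzf !nzff ?leq_addr //; lia.
Qed.

Lemma jpoly5_centered (F : numFieldType) n (x : 'I_n -> F) : (5 <= n)%N ->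
  \sum_i x i = 0 ->
  let N := n%:R : F in
  let p := psum x in
  jpoly 5 x = quintic
    (10%:R * p 2%N / (N * (N - 1)))
    (20%:R * p 3%N / (N * (N - 1) * (N - 2%:R)))
    ((15%:R * p 2%N ^+ 2 - 30%:R * p 4%N)
      / (N * (N - 1) * (N - 2%:R) * (N - 3%:R)))
    ((20%:R * p 2%N * p 3%N - 24%:R * p 5%N)
      / (N * (N - 1) * (N - 2%:R) * (N - 3%:R) * (N - 4%:R))).
Proof.
move=> le5n; rewrite -(subnK le5n) in x *; move: (n - 5)%N x => m x {n le5n} x0 N p.
set s := [seq x i | i : 'I_(m + 5)].
have psE r : \sum_(y <- s) y ^+ r = p r by rewrite big_image.
have [|q1 q2 q3 q4 q5] := @newton5_centered F s.
  by rewrite big_image /= -[RHS]x0; apply: eq_bigr => i _; rewrite expr1.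
rewrite !psE in q1 q2 q3 q4 q5.
(* These are the factors n - i of the denominators, in the form needed by [field]. *)
have nzN i : (i < 5)%N -> m%:R + 5%:R - i%:R != 0 :> F.
  move=> lt_i5; rewrite -natrD -natrB ?pnatr_eq0; last by lia.
  by rewrite -lt0n subn_gt0; lia.
have := (nzN 0%N isT, nzN 1%N isT); rewrite subr0 => -[nz0 nz1].
have NE : N = m%:R + 5%:R by rewrite /N natrD.
apply/polyP=> j; rewrite coef_quintic.
have [lt5j | le_j5] := ltnP 5 j.
  rewrite [RHS]nth_default // /jpoly addnK coefZ coef_derivn nth_default.
    by rewrite mul0rn mulr0.
  by rewrite size_root_poly -addnS leq_add2l.
rewrite coef_jpoly //; move: le_j5.
case: j => [|[|[|[|[|[|j]]]]]] // _; rewrite ?subnn /= -/s ?q1 ?q2 ?q3 ?q4 ?q5 ?NE /=.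
all: rewrite ?[(m + 5)%N]addnC ?ffactSS ?ffactn0 ?factS ?fact0 ?natrM.
all: rewrite ?mulr0 ?coef0_rev_root_poly //.
all: by field; rewrite ?nz0 ?nz1 ?nzN.
Qed.

Theorem proposition13 (n : nat) (hn : (5 <= n)%N) :
  [/\ (forall (C : numClosedFieldType) (x : 'I_n -> C),
         \sum_(i < n) x i = 0 ->
         let N := n%:R : C in
         let p := psum x in
         jpoly 5 x =
           'X^5
           - (10%:R * p 2%N / (N * (N - 1))) *: 'X^3
           - (20%:R * p 3%N / (N * (N - 1) * (N - 2%:R))) *: 'X^2
           + ((15%:R * p 2%N ^+ 2 - 30%:R * p 4%N)
                / (N * (N - 1) * (N - 2%:R) * (N - 3%:R))) *: 'X
           + ((20%:R * p 2%N * p 3%N - 24%:R * p 5%N)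
                / (N * (N - 1) * (N - 2%:R) * (N - 3%:R) * (N - 4%:R)))%:P),
      (exists D : {mpoly rat[4]},
         forall (C : numClosedFieldType) (x : 'I_n -> C),
           \sum_(i < n) x i = 0 ->
           discriminant (jpoly 5 x) =
             (map_mpoly ratr D).@[fun i : 'I_4 => psum x (i + 2)])
    & (forall (C : numClosedFieldType) (x : 'I_n -> C),
         \sum_(i < n) x i = 0 ->
         (forall i : 'I_n, x i \is Num.real) ->
         0 <= discriminant (jpoly 5 x))].
Proof.
have formula := jpoly5_centered hn.
split=> [C x x0 | | C x x0 x_real]; first exact: formula.
(* [G] is the quintic with variable number i in place of the power sum of order i + 2; the
   denominators depend only on n and are inverted in [rat] as constants. *)
- pose inv (r : rat) : {mpoly rat[4]} := (r^-1)%:MP.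
  pose M : rat := n%:R.
  pose p (i : 'I_4) : {mpoly rat[4]} := 'X_i.
  pose G := quintic
    (10%:R * p 0 * inv (M * (M - 1)))
    (20%:R * p 1 * inv (M * (M - 1) * (M - 2%:R)))
    ((15%:R * p 0 ^+ 2 - 30%:R * p 2%:R)
      * inv (M * (M - 1) * (M - 2%:R) * (M - 3%:R)))
    ((20%:R * p 0 * p 1 - 24%:R * p 3%:R)
      * inv (M * (M - 1) * (M - 2%:R) * (M - 3%:R) * (M - 4%:R))).
  exists (resultant G G^`()) => C x x0.
  pose v (i : 'I_4) := psum x (i + 2).
  (* Embedding the coefficients into [C] and then evaluating at the power sums is a ring morphism
     that sends [G] to [jpoly 5 x]. *)
  pose phi : {rmorphism {mpoly rat[4]} -> C} := meval v \o map_mpoly ratr.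
  rewrite formula // -/(quintic _ _ _ _).
  rewrite -[RHS]/(phi _) -discriminant_quintic_map.
  have phiX i : phi (p i) = v i by rewrite /phi /= map_mpolyX mevalXU.
  have phiC r : phi (inv r) = (ratr r)^-1.
    by rewrite /phi /= map_mpolyC mevalC; apply: fmorphV.
  rewrite !(rmorphM, rmorphB, rmorphXn, rmorph_nat, phiX, phiC) /=.
  by rewrite rmorph1.
rewrite formula //; apply: discriminant_real_rooted.
- exact: quintic_monic.
- by rewrite size_quintic.
(* The explicit form gave monicity and degree; real roots come from the form as a derivative of
   [root_poly x], so the formula is undone. *)
rewrite -formula // => z.
rewrite /jpoly rootZ ?mulf_neq0 ?invr_eq0 ?pnatr_eq0 -?lt0n ?fact_gt0 //.
apply: derivn_real_rooted => [{}z|]; last by rewrite size_root_poly ltnS leq_subr.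
rewrite /root horner_prod => /prodf_eq0[i _].
by rewrite hornerXsubC subr_eq0 => /eqP->.
Qed.
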